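(* For all integers $m,p,q\geq 2$, the number $$(-1)^m\sum_{\substack{i+j=p-1\\ i,j\geq 0}}\binom{m+i-1}{i}\binom{q+j-1}{j}T(m+i,q+j)+(-1)^p\sum_{\substack{i+j=m-1\\ i,j\geq 0}}\binom{p+i-1}{i}\binom{q+j-1}{j}T(p+i,q+j)$$ lies in $\mathbb{Q}[\text{zeta values}]$. In particular, $2^{m+p+q-3}$ times this number is equal to $$\begin{aligned}&\binom{m+p+q-2}{q-1}\tilde t(m+p+q-1)\\&+(-1)^m\sum_{\substack{i+j=p-1\\ i,j\geq 0}}\binom{m+i-1}{i}\binom{q+j-1}{j}\bigl(1+(-1)^{m+i}\bigr)\zeta(m+i)\,\tilde t(q+j)\\&+(-1)^p\sum_{\substack{i+j=m-1\\ i,j\geq 0}}\binom{p+i-1}{i}\binom{q+j-1}{j}\bigl(1+(-1)^{p+i}\bigr)\zeta(p+i)\,\tilde t(q+j)\\&-\sum_{\substack{i+j=q-1\\ i,j\geq 0}}\binom{m+i-1}{i}\binom{p+j-1}{j}\tilde t(m+i)\,\tilde t(p+j).\end{aligned}$$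
   Context: For integers $a\geq 2$, $b\geq 1$, the double $T$-value is $T(a,b)=4\sum_{n_1>n_2\geq 1}\frac{1}{(2n_1-2)^{a}(2n_2-1)^{b}}$. For integers $s\geq 2$: $\zeta(s)=\sum_{n\geq1}n^{-s}$ is the Riemann zeta value and $\tilde t(s)=\sum_{n=1}^\infty\frac{1}{(n-1/2)^s}=(2^s-1)\zeta(s)$. $\mathbb{Q}[\text{zeta values}]$ denotes the $\mathbb{Q}$-subalgebra of $\mathbb{R}$ generated by the numbers $\zeta(k)$, $k\geq 2$ an integer. *)

(* Defs.v *)
From HB Require Import structures.
From mathcomp Require Import all_boot all_order all_algebra.
From mathcomp Require Import all_classical all_reals all_analysis.

Set Implicit Arguments.
Unset Strict Implicit.
Unset Printing Implicit Defensive.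

Import Order.TTheory GRing.Theory Num.Theory.
Import numFieldNormedType.Exports.

Local Open Scope classical_set_scope.
Local Open Scope ring_scope.

(* The three series below converge for s >= 2, respectively a >= 2 and b >= 1;
   outside this range the values are meaningless. *)
Definition zeta (R : realType) (s : nat) : R :=
  limn (fun N => \sum_(1 <= n < N) (n%:R ^+ s)^-1 : R).

Definition ttilde (R : realType) (s : nat) : R :=
  limn (fun N => \sum_(1 <= n < N) ((n%:R - 2^-1) ^+ s)^-1 : R).

(* The summand for n1 = 1 is an empty sum, so 2 n1 - 2 = 0 never occurs in a
   denominator. *)
Definition doubleT (R : realType) (a b : nat) : R :=
  4 * limn (fun N => \sum_(1 <= n1 < N) \sum_(1 <= n2 < n1)
              ((2 * n1%:R - 2) ^+ a * (2 * n2%:R - 1) ^+ b)^-1 : R).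

Definition rat_subalgebra (R : realType) (S : set R) : Prop :=
  [/\ forall c : rat, S (ratr c),
      forall x y, S x -> S y -> S (x + y)
    & forall x y, S x -> S y -> S (x * y)].

Definition zeta_algebra (R : realType) : set R :=
  smallest (@rat_subalgebra R) [set zeta R k | k in [set k | (2 <= k)%N]].
Arguments zeta_algebra R : clear implicits.

(* Main.v *)
Require Import Defs.
From HB Require Import structures.
From mathcomp Require Import all_boot all_order all_algebra.
From mathcomp Require Import all_classical all_reals all_analysis.
From mathcomp Require Import ring lra zify.

(** For half-integers [x <> y] the rational function
    [1 / ((x - s)^m (y - s)^p s^q)] of [s] decays fast enough at infinity for
    its residues at [0], [x] and [y] to add up to zero.  Written out, this is
    a partial fraction identity ([partial_fraction]) between sums of products
    of binomial coefficients:
    - the residue at [0] is a combination of the [x^-(m+i) y^-(p+j)] with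
      [i + j = q - 1];
    - the residue at [x] is a combination of the [(x - y)^-(p+i) x^-(q+j)] with
      [i + j = m - 1];
    - the residue at [y] is the same with [x] and [y], [m] and [p] exchanged.

    Sum over all pairs of distinct positive half-integers below [N] and let
    [N] go to infinity.  The residues at [0] give products of two values of
    [ttilde], minus the diagonal [x = y], whose terms collapse by a Vandermonde
    convolution ([convol_pole_diag]) to one multiple of
    [ttilde (m + p + q - 1)].  In the residues at [x], where
    [x = k + 1/2], the differences [x - y] run through the integers from
    [k - N + 1] to [k] except [0].  The negative ones form a Cauchy product,
    which tends to [(-1)^s zeta s * ttilde b] ([cvg_cauchy_product]).  The
    positive ones sum over the pairs of an integer [n] and a half-integer [x]
    with [n < x]; these are all pairs but those with [x < n], and the latter
    make up a rescaled [doubleT s b] ([sum_mul_series], [cvg_doubleT]).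
    Solving the resulting relation ([ttilde_doubleT_relation]) for [doubleT]
    gives the formula.

    Its right-hand side is a rational polynomial in zeta values because
    [ttilde s = (2^s - 1) zeta s] ([ttilde_zeta]), so the first claim follows
    from the second. *)

Set Implicit Arguments.
Unset Strict Implicit.
Unset Printing Implicit Defensive.

Import Order.TTheory GRing.Theory Num.Theory.
Import numFieldNormedType.Exports.

Local Open Scope ring_scope.

(** * Partial fractions *)

(** The coefficient of [s^i] in the power series of [(x - s)^-m].  The truncated
    subtraction makes it [1, 0, 0, ...] for [m = 0], as it should be. *)
Definition pole_coef (F : fieldType) (x : F) (m i : nat) : F :=
  'C(m + i - 1, i)%:R / x ^+ (m + i).

(** The coefficient of [s^(n-1)] in a product of power series.  Indexing by the
    number of terms lets [n = 0] stand for the vanishing coefficient of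
    [s^-1], so that the recursions below need no boundary case. *)
Definition convol (F : fieldType) (n : nat) (f g : nat -> F) : F :=
  \sum_(i < n) f i * g (n - i.+1)%N.

(** Multiplication of a power series by its variable. *)
Definition shift_coef (F : fieldType) (f : nat -> F) (i : nat) : F :=
  if i is i'.+1 then f i' else 0.

Section PoleCoefficients.
Variable F : fieldType.
Implicit Types (f g h : nat -> F) (x y : F) (m p q n : nat).

Lemma eq_convol n f f' g g' : f =1 f' -> g =1 g' -> convol n f g = convol n f' g'.
Proof. by move=> ff gg; apply: eq_bigr => i _; rewrite ff gg. Qed.

Lemma convolC n f g : convol n f g = convol n g f.
Proof.
rewrite /convol (reindex_inj rev_ord_inj) /=; apply: eq_bigr => i _.
by rewrite mulrC; congr (g _ * f _); have := ltn_ord i; lia.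
Qed.

Lemma convolDl n f g h :
  convol n (fun i => f i + g i) h = convol n f h + convol n g h.
Proof. by rewrite -big_split; apply: eq_bigr => i _; rewrite mulrDl. Qed.

Lemma convolZl n c f g : convol n (fun i => c * f i) g = c * convol n f g.
Proof. by rewrite mulr_sumr; apply: eq_bigr => i _; rewrite mulrA. Qed.

Lemma convol_shiftl n f g : convol n (shift_coef f) g = convol n.-1 f g.
Proof.
case: n => [|n]; first by rewrite /convol !big_ord0.
by rewrite /convol big_ord_recl mul0r add0r.
Qed.

(** Multiplying [(x - s)^-(m+1)] by [x = (x - s) + s]; on coefficients this is
    Pascal's rule. *)
Lemma pole_coefS x m i : x != 0 ->
  x * pole_coef x m.+1 i = pole_coef x m i + shift_coef (pole_coef x m.+1) i.
Proof.
move=> x0; rewrite /pole_coef; case: i => [|i] /=.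
  by rewrite !bin0 !addn0 addr0 !mul1r exprS; field; rewrite expf_neq0 ?x0.
have -> : (m.+1 + i.+1 - 1 = (m + i).+1)%N by lia.
have -> : (m + i.+1 - 1 = m + i)%N by lia.
have -> : (m.+1 + i - 1 = m + i)%N by lia.
have -> : (m.+1 + i.+1 = (m + i).+2)%N by lia.
have -> : (m + i.+1 = (m + i).+1)%N by lia.
rewrite binS natrD addSn !exprS; field.
by rewrite expf_neq0 ?x0.
Qed.

Lemma pole_coef0 x i : pole_coef x 0 i = (i == 0%N)%:R.
Proof.
rewrite /pole_coef; case: i => [|i]; first by rewrite bin0 expr0 divr1.
by rewrite add0n subn1 /= bin_small // mul0r.
Qed.

Lemma convol_pole0l n x f : convol n.+1 (pole_coef x 0) f = f n.
Proof.
rewrite /convol big_ord_recl pole_coef0 mul1r subn1 big1 ?addr0 // => i _.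
by rewrite pole_coef0 mul0r.
Qed.

Lemma convol_pole0r n x f : convol n.+1 f (pole_coef x 0) = f n.
Proof. by rewrite convolC convol_pole0l. Qed.

Lemma convol_poleS n x m f : x != 0 ->
  x * convol n (pole_coef x m.+1) f =
  convol n (pole_coef x m) f + convol n.-1 (pole_coef x m.+1) f.
Proof.
move=> x0; rewrite -convolZl -convol_shiftl -convolDl.
by apply: eq_convol => // i; rewrite pole_coefS.
Qed.

(** The two poles merge: the product of [(x - s)^-m] and [(x - s)^-p] is
    [(x - s)^-(m+p)]. *)
Lemma convol_pole_diag q x m p : x != 0 ->
  convol q.+1 (pole_coef x m) (pole_coef x p) = pole_coef x (m + p) q.
Proof.
move=> x0; elim: m q => [|m IHm] q; first by rewrite convol_pole0l.
elim: q => [|q IHq]; apply: (mulfI x0); rewrite convol_poleS // IHm addSn pole_coefS //=.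
  by rewrite {1}/convol big_ord0.
by rewrite IHq addSn.
Qed.

(** Since [y - x = (y - s) - (x - s)], multiplying
    [F(m,p) = (x - s)^-m (y - s)^-p s^-(q+1)] by [y - x] gives
    [F(m,p-1) - F(m-1,p)].  Each of the three residues obeys this recursion, and
    it reduces the claim to [m = 0] or [p = 0], where only one pole is left
    besides [0]. *)
Lemma partial_fraction m p q x y : x != 0 -> y != 0 -> x != y -> (0 < m + p)%N ->
  convol q.+1 (pole_coef x m) (pole_coef y p) =
  (-1) ^+ p * convol m (pole_coef (x - y) p) (pole_coef x q.+1)
  + (-1) ^+ m * convol p (pole_coef (y - x) m) (pole_coef y q.+1).
Proof.
move=> x0 y0 xy.
have xy0 : x - y != 0 by rewrite subr_eq0.
have yx0 : y - x != 0 by rewrite subr_eq0 eq_sym.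
(* the base cases: [(z - s)^-(a+1) s^-(q+1)] has the poles [0] and [z] only, and
   the two sides are its residue at [0] and minus its residue at [z] *)
have pq z a : pole_coef z a.+1 q = pole_coef z q.+1 a.
  rewrite /pole_coef -[in LHS](bin_sub (m := q)); last by lia.
  by congr ('C(_, _)%:R / _ ^+ _); lia.
move: {2}(m + p)%N (leqnn (m + p)) => s.
elim: s m p => [|s IH] m p; first by lia.
case: m => [|m]; case: p => [|p] le_s //= _.
- by rewrite convol_pole0l {1}/convol big_ord0 mulr0 add0r mul1r convol_pole0l pq.
- by rewrite convol_pole0r {2}/convol big_ord0 mulr0 addr0 mul1r convol_pole0l pq.
apply: (mulfI yx0).
have -> : (y - x) * convol q.+1 (pole_coef x m.+1) (pole_coef y p.+1) =
    convol q.+1 (pole_coef x m.+1) (pole_coef y p)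
    - convol q.+1 (pole_coef x m) (pole_coef y p.+1).
  rewrite mulrBl convol_poleS // [in y * _]convolC convol_poleS //.
  by rewrite ![convol _ (pole_coef y _) _]convolC; ring.
rewrite !IH //; try lia.
rewrite mulrDr.
have -> : (y - x) * ((-1) ^+ p.+1 * convol m.+1 (pole_coef (x - y) p.+1) (pole_coef x q.+1))
  = (-1) ^+ p * ((x - y) * convol m.+1 (pole_coef (x - y) p.+1) (pole_coef x q.+1)).
  by rewrite exprS; ring.
have -> : (y - x) * ((-1) ^+ m.+1 * convol p.+1 (pole_coef (y - x) m.+1) (pole_coef y q.+1))
  = (-1) ^+ m.+1 * ((y - x) * convol p.+1 (pole_coef (y - x) m.+1) (pole_coef y q.+1)).
  by ring.
by rewrite !convol_poleS //= !exprS; ring.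
Qed.

End PoleCoefficients.

Local Open Scope classical_set_scope.

(** * Limits of sums of products *)

Section Series.
Variable R : realType.
Implicit Types (u v : R ^nat) (a b : R).

Lemma series_ge0 u n : (forall k, 0 <= u k) -> 0 <= series u n.
Proof. by move=> u0; apply: sumr_ge0. Qed.

Lemma nondecreasing_series_ge0 u : (forall k, 0 <= u k) ->
  nondecreasing_seq (series u).
Proof. by move=> u0; apply: nondecreasing_series. Qed.

Lemma series_le_lim u a n : (forall k, 0 <= u k) ->
  series u @ \oo --> a -> series u n <= a.
Proof.
move=> u0 cu; rewrite -(cvg_lim _ cu)//.
by apply: nondecreasing_cvgn_le; [exact: nondecreasing_series_ge0|exact: cvgP cu].
Qed.

(** The sum runs over the triangle [k + l < N - 1], which contains the square of
    side [N / 2] and lies in the square of side [N]; over both squares the sum is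
    a product of partial sums. *)
Lemma cvg_cauchy_product u v a b :
  (forall k, 0 <= u k) -> (forall k, 0 <= v k) ->
  series u @ \oo --> a -> series v @ \oo --> b ->
  \sum_(0 <= k < N) u k * series v (N - k.+1)%N @[N --> \oo] --> a * b.
Proof.
move=> u0 v0 cu cv.
have ndu := nondecreasing_series_ge0 u0; have ndv := nondecreasing_series_ge0 v0.
have cprod : (series u \* series v) @ \oo --> a * b by exact: cvgM.
apply: (@squeeze_cvgr _ _ _ _ (fun N => series u (N %/ 2)%N * series v (N %/ 2)%N)
  (fun N => series u N * series v N)); last by exact: cprod.
- near=> N; apply/andP; split.
    rewrite /series /= mulr_suml.
    rewrite [leRHS](@big_cat_nat _ _ _ (N %/ 2)) //=; last by lia.
    rewrite -[leLHS]addr0; apply: lerD; last first.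
      by apply: sumr_ge0 => k _; rewrite mulr_ge0 ?sumr_ge0.
    apply: ler_sum_nat => k /andP[_ kN]; rewrite ler_wpM2l //.
    by apply: ndv; lia.
  rewrite /series /= mulr_suml; apply: ler_sum_nat => k /andP[_ kN].
  by rewrite ler_wpM2l //; apply: ndv; lia.
- exact: (cvg_comp _ _ (@cvg_divnr 2 isT) cprod).
Unshelve. all: by end_near. Qed.

(** Splits the square of side [N] along its diagonal. *)
Lemma sum_mul_series u v N :
  \sum_(0 <= k < N) u k * series v k =
  series u N * series v N - \sum_(0 <= n < N) v n * series u n.+1.
Proof.
elim: N => [|N IH]; first by rewrite /series /= !big_geq // mul0r subr0.
by rewrite !big_nat_recr //= IH !seriesSr; ring.
Qed.

Lemma is_cvg_sum_mul_series u v a b :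
  (forall k, 0 <= u k) -> (forall k, 0 <= v k) ->
  series u @ \oo --> a -> series v @ \oo --> b ->
  cvgn (fun N => \sum_(0 <= n < N) v n * series u n.+1).
Proof.
move=> u0 v0 cu cv; apply: nondecreasing_is_cvgn.
  by apply: nondecreasing_series => n _ _; rewrite mulr_ge0 ?series_ge0.
exists (b * a) => _ [N _ <-].
apply: (@le_trans _ _ (series v N * a)).
  rewrite /series /= mulr_suml; apply: ler_sum => n _.
  by rewrite ler_wpM2l // series_le_lim.
have a0 : 0 <= a by have := series_le_lim 0 u0 cu; apply: le_trans; exact: series_ge0.
by rewrite ler_wpM2r // series_le_lim.
Qed.

(** * Zeta, ttilde and doubleT as limits of series *)

(** The series of the Hurwitz zeta function: [zeta] is the case [c = 1] and
    [ttilde] the case [c = 1/2]. *)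
Definition hurwitz_term (c : R) (s k : nat) : R := ((k%:R + c) ^+ s)^-1.

Lemma hurwitz_term_ge0 c s k : 0 <= c -> 0 <= hurwitz_term c s k.
Proof. by move=> c0; rewrite invr_ge0 exprn_ge0 // addr_ge0. Qed.

(** As [c >= 1/2], the [k]-th term is at most [2^s / (k+1)^2], and the sum of the
    first [N] numbers [1 / (k+1)^2] is at most [2 - 1/N]. *)
Lemma is_cvg_hurwitz c s : 2^-1 <= c -> (2 <= s)%N ->
  cvgn (series (hurwitz_term c s)).
Proof.
move=> c2 s2.
have c0 : 0 < c by apply: lt_le_trans c2; rewrite invr_gt0.
have ge0 k : 0 <= hurwitz_term c s k by apply: hurwitz_term_ge0; exact: ltW.
have term_le k : hurwitz_term c s k <= 2 ^+ s * (k.+1%:R ^+ 2)^-1.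
  have k1 : (1 : R) <= k.+1%:R by rewrite ler1n.
  apply: (@le_trans _ _ (2 ^+ s * (k.+1%:R ^+ s)^-1)); last first.
    rewrite ler_wpM2l ?exprn_ge0 // lef_pV2 ?posrE ?exprn_gt0 ?ltr0n //.
    by rewrite ler_weXn2l.
  rewrite -exprVn -exprMn /hurwitz_term -exprVn lerXn2r ?nnegrE //.
    by rewrite invr_ge0 addr_ge0 // ltW.
  rewrite -[X in X * _]invrK -invfM lef_pV2 ?posrE.
    + by rewrite -[k.+1%:R]natr1; have := ler0n R k; move: c2; lra.
    + by rewrite ltr_wpDl.
    + by rewrite mulr_gt0 ?invr_gt0.
apply: nondecreasing_is_cvgn; first exact: nondecreasing_series_ge0.
have bound N : series (hurwitz_term c s) N.+1 <= 2 ^+ s * (2 - N.+1%:R^-1).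
  elim: N => [|N IH].
    rewrite /series /= big_nat1 (le_trans (term_le 0%N)) // expr1n invr1.
    by rewrite ler_wpM2l ?exprn_ge0 //; lra.
  rewrite seriesSr (le_trans (lerD IH (term_le _))) // -mulrDr.
  rewrite ler_wpM2l ?exprn_ge0 //.
  have N1 : (0 : R) < N.+1%:R by rewrite ltr0n.
  rewrite -[N.+2%:R]natr1; move: N.+1%:R N1 => x x0.
  rewrite -subr_ge0.
  have -> : 2 - (x + 1)^-1 - (2 - x^-1 + ((x + 1) ^+ 2)^-1) = (x * (x + 1) ^+ 2)^-1.
    by field; rewrite !gt_eqF // addr_gt0.
  by rewrite invr_ge0 mulr_ge0 ?exprn_ge0 // ltW // addr_gt0.
exists (2 ^+ s * 2) => _ [N _ <-].
apply: (@le_trans _ _ (series (hurwitz_term c s) N.+1)).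
  exact: nondecreasing_series_ge0.
rewrite (le_trans (bound N)) // ler_wpM2l ?exprn_ge0 //.
by rewrite gerDl oppr_le0 invr_ge0.
Qed.

Lemma cvg_zeta s : (2 <= s)%N ->
  series (hurwitz_term 1 s) @ \oo --> zeta R s.
Proof.
move=> s2.
have -> : zeta R s = limn (series (hurwitz_term 1 s)); last first.
  by apply: is_cvg_hurwitz s2; lra.
rewrite /zeta; apply: cvg_lim => //; rewrite -cvg_shiftS.
rewrite (_ : (fun N => _) = series (hurwitz_term 1 s)); last first.
  apply/funext => N; rewrite big_add1; apply: eq_bigr => k _.
  by rewrite /hurwitz_term natr1.
by apply: is_cvg_hurwitz s2; lra.
Qed.

Lemma cvg_ttilde s : (2 <= s)%N ->
  series (hurwitz_term 2^-1 s) @ \oo --> ttilde R s.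
Proof.
move=> s2.
have -> : ttilde R s = limn (series (hurwitz_term 2^-1 s)); last first.
  by apply: is_cvg_hurwitz s2; lra.
rewrite /ttilde; apply: cvg_lim => //; rewrite -cvg_shiftS.
rewrite (_ : (fun N => _) = series (hurwitz_term 2^-1 s)); last first.
  apply/funext => N; rewrite big_add1; apply: eq_bigr => k _.
  by rewrite /hurwitz_term -natr1; congr (_ ^+ _)^-1; field.
by apply: is_cvg_hurwitz s2; lra.
Qed.

(** The first [2 N] terms of the zeta series, split into odd and even
    denominators. *)
Lemma ttilde_zeta s : (2 <= s)%N -> ttilde R s = (2 ^+ s - 1) * zeta R s.
Proof.
move=> s2.
have split N : series (hurwitz_term 1 s) (N * 2)%N =
    (2 ^+ s)^-1 * (series (hurwitz_term 2^-1 s) N + series (hurwitz_term 1 s) N).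
  elim: N => [|N IH]; first by rewrite /series /= !big_geq // addr0 mulr0.
  rewrite mulSn !addSn add0n !seriesSr IH !mulrDr -!addrA; congr (_ + _).
  rewrite [RHS]addrCA; congr (_ + _).
  rewrite /hurwitz_term -!invfM -!exprMn.
  by congr ((_ ^+ _)^-1 + (_ ^+ _)^-1); rewrite -?natr1 natrM; field.
have c1 : series (hurwitz_term 1 s) (N * 2)%N @[N --> \oo] --> zeta R s.
  exact: (cvg_comp _ _ (@cvg_mulnr 2 isT) (cvg_zeta s2)).
have c2 : (2 ^+ s)^-1 * (series (hurwitz_term 2^-1 s) N + series (hurwitz_term 1 s) N)
    @[N --> \oo] --> (2 ^+ s)^-1 * (ttilde R s + zeta R s).
  by apply: cvgMl_tmp; apply: cvgD; [exact: cvg_ttilde|exact: cvg_zeta].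
have e : zeta R s = (2 ^+ s)^-1 * (ttilde R s + zeta R s).
  by move: c1; rewrite (funext split) => c1; exact: (cvg_unique _ c1 c2).
have p2 : 2 ^+ s != 0 :> R by rewrite expf_neq0.
by rewrite mulrBl mul1r {1}e mulrA divff // mul1r addrK.
Qed.

(** With [n1 = n + 2] and [n2 = k + 1], the bases are [2 (n + 1)] and
    [2 (k + 1/2)]; taking the powers of [2] out leaves Hurwitz terms. *)
Lemma cvg_doubleT (a b : nat) : (2 <= a)%N -> (2 <= b)%N ->
  \sum_(0 <= n < N) hurwitz_term 1 a n * series (hurwitz_term 2^-1 b) n.+1
    @[N --> \oo] --> 2 ^+ (a + b) / 4 * doubleT R a b.
Proof.
move=> a2 b2; set D := (X in X @ _ --> _).
have cD : cvgn D.
  by apply: is_cvg_sum_mul_series (cvg_ttilde b2) (cvg_zeta a2) => k;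
    apply: hurwitz_term_ge0; lra.
have -> : doubleT R a b = 4 * ((2 ^+ (a + b))^-1 * limn D).
  rewrite /doubleT; congr (4 * _); apply: cvg_lim => //.
  have cD2 : (2 ^+ (a + b))^-1 * D N @[N --> \oo] --> (2 ^+ (a + b))^-1 * limn D.
    exact: cvgMl_tmp.
  rewrite -cvg_shiftS -cvg_shiftS.
  rewrite (_ : (fun N => _) = (fun N => (2 ^+ (a + b))^-1 * D N)) //.
  apply/funext => N.
  (* the term [n1 = 1] is an empty sum *)
  rewrite [LHS]/= big_add1 big_nat_recl //= big_geq // add0r mulr_sumr.
  apply: eq_bigr => n _; rewrite big_add1 /series /= !mulr_sumr.
  apply: eq_bigr => k _; rewrite /hurwitz_term exprD -!invfM mulrACA -!exprMn.
  by congr (_ ^+ _ * _ ^+ _)^-1; rewrite -?natr1; field.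
have p2 : 2 ^+ (a + b) != 0 :> R by rewrite expf_neq0.
have -> // : 2 ^+ (a + b) / 4 * (4 * ((2 ^+ (a + b))^-1 * limn D)) = limn D.
by field; rewrite p2.
Qed.

End Series.

(** * Summation over pairs of half-integers *)

Lemma sum_neq (V : zmodType) (N k : nat) (f : nat -> V) : (k < N)%N ->
  \sum_(0 <= l < N | l != k) f l = \sum_(0 <= l < N) f l - f k.
Proof.
move=> kN; rewrite [in RHS](bigD1_seq k) ?iota_uniq ?mem_index_iota //=.
by rewrite addrAC subrr add0r.
Qed.

Lemma sum_antidiag (V : nmodType) (n : nat) (G : nat -> nat -> V) :
  \sum_(i < n) \sum_(j < n | (i + j == n - 1)%N) G i j =
  \sum_(i < n) G i (n - i.+1)%N.
Proof.
apply: eq_bigr => i _; rewrite (big_pred1 (rev_ord i)) // => j.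
by rewrite /= -[j == _]val_eqE /=; have := ltn_ord i; have := ltn_ord j; lia.
Qed.

Section HalfIntegers.
Variable R : realType.

Definition half_int (k : nat) : R := k%:R + 2^-1.

Lemma half_int_neq0 k : half_int k != 0.
Proof. by rewrite gt_eqF // /half_int ltr_wpDl // invr_gt0. Qed.

(** The differences are [k, ..., 1] for [l < k] and [-1, ..., -(N-1-k)] for
    [l > k]. *)
Lemma sum_half_int_diff N k s : (k < N)%N ->
  \sum_(0 <= l < N | l != k) ((half_int k - half_int l) ^+ s)^-1 =
  series (hurwitz_term (1 : R) s) k
  + (-1) ^+ s * series (hurwitz_term (1 : R) s) (N - k.+1)%N.
Proof.
move=> kN; have diff l : half_int k - half_int l = k%:R - l%:R.
  by rewrite /half_int; ring.
rewrite (@big_cat_nat _ _ _ k) //=; last exact: ltnW.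
congr (_ + _).
  rewrite big_nat_cond big_nat_rev /= /series /= add0n big_nat_cond [RHS]big_nat_cond.
  apply: eq_big => l; first by lia.
  move=> /andP[/andP[_ lk] _].
  rewrite diff /hurwitz_term; congr (_ ^+ _)^-1.
  by rewrite natrB //= -natr1; ring.
rewrite big_ltn_cond //= eqxx /= -[in LHS](add0n k.+1) big_addn.
rewrite /series /= mulr_sumr; apply: eq_big => l; first by lia.
move=> _; rewrite diff /hurwitz_term addnS -addSn natrD opprD addrCA subrr addr0.
by rewrite [in LHS]exprNn [LHS]invfM -[X in X * _]exprVn invrN1 natr1.
Qed.

(** The sum over [k, l < N], [l <> k], of
    [(half_int k)^-b (half_int k - half_int l)^-s], in the form that
    [sum_half_int_diff] gives it. *)
Definition offdiag_sum (s b N : nat) : R :=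
  \sum_(0 <= k < N) hurwitz_term 2^-1 b k *
    (series (hurwitz_term 1 s) k
     + (-1) ^+ s * series (hurwitz_term 1 s) (N - k.+1)%N).

(** The part with [l < k] contributes [zeta s * ttilde b] minus the [doubleT] term,
    the part with [l > k] a full product with sign [(-1)^s]. *)
Lemma cvg_offdiag_sum s b : (2 <= s)%N -> (2 <= b)%N ->
  offdiag_sum s b @ \oo -->
    (1 + (-1) ^+ s) * zeta R s * ttilde R b - 2 ^+ (s + b) / 4 * doubleT R s b.
Proof.
move=> s2 b2; have cz := @cvg_zeta R s s2; have ct := @cvg_ttilde R b b2.
rewrite (_ : offdiag_sum s b = fun N =>
    (series (hurwitz_term 2^-1 b) N * series (hurwitz_term 1 s) N
     - \sum_(0 <= n < N) hurwitz_term 1 s n * series (hurwitz_term 2^-1 b) n.+1)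
    + (-1) ^+ s * \sum_(0 <= k < N)
        hurwitz_term 2^-1 b k * series (hurwitz_term 1 s) (N - k.+1)%N); last first.
  apply/funext => N; rewrite -sum_mul_series mulr_sumr -big_split.
  by apply: eq_bigr => k _; rewrite mulrDr mulrCA.
rewrite (_ : _ - _ = (ttilde R b * zeta R s - 2 ^+ (s + b) / 4 * doubleT R s b)
    + (-1) ^+ s * (ttilde R b * zeta R s)); last by ring.
apply: cvgD; [apply: cvgB; [exact: cvgM|exact: cvg_doubleT]|apply: cvgMl_tmp].
by apply: cvg_cauchy_product => // k; apply: hurwitz_term_ge0; lra.
Qed.

(** The total residue at the poles [x]. *)
Lemma sum_convol_offdiag m p q N :
  \sum_(0 <= k < N) \sum_(0 <= l < N | l != k)
    convol m (pole_coef (half_int k - half_int l) p) (pole_coef (half_int k) q) =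
  \sum_(i < m) 'C(p + i - 1, i)%:R * 'C(q + (m - i.+1) - 1, m - i.+1)%:R
    * offdiag_sum (p + i) (q + (m - i.+1)) N.
Proof.
transitivity (\sum_(0 <= k < N) \sum_(i < m) \sum_(0 <= l < N | l != k)
    pole_coef (half_int k - half_int l) p i * pole_coef (half_int k) q (m - i.+1)).
  by apply: eq_bigr => k _; rewrite exchange_big.
rewrite exchange_big; apply: eq_bigr => i _; rewrite mulr_sumr.
apply: eq_big_nat => k /andP[_ kN]; rewrite -sum_half_int_diff // !mulr_sumr.
by apply: eq_bigr => l _; rewrite /pole_coef /hurwitz_term; ring.
Qed.

(** The total residue at [0]: the full square minus its diagonal. *)
Lemma sum_convol_pole m p q N :
  \sum_(0 <= k < N) \sum_(0 <= l < N | l != k)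
    convol q.+1 (pole_coef (half_int k) m) (pole_coef (half_int l) p) =
  \sum_(i < q.+1) 'C(m + i - 1, i)%:R * 'C(p + (q.+1 - i.+1) - 1, q.+1 - i.+1)%:R
    * (series (hurwitz_term 2^-1 (m + i)) N
       * series (hurwitz_term 2^-1 (p + (q.+1 - i.+1))) N)
  - 'C(m + p + q - 1, q)%:R * series (hurwitz_term 2^-1 (m + p + q)) N :> R.
Proof.
transitivity (\sum_(0 <= k < N) (\sum_(0 <= l < N)
    convol q.+1 (pole_coef (half_int k) m) (pole_coef (half_int l) p)
    - pole_coef (half_int k) (m + p) q)).
  apply: eq_big_nat => k /andP[_ kN]; rewrite sum_neq //.
  by rewrite convol_pole_diag // half_int_neq0.
rewrite big_split /= sumrN; congr (_ - _); last by rewrite mulr_sumr.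
transitivity (\sum_(0 <= k < N) \sum_(i < q.+1) \sum_(0 <= l < N)
    pole_coef (half_int k) m i * pole_coef (half_int l) p (q.+1 - i.+1)).
  by apply: eq_bigr => k _; rewrite exchange_big.
rewrite exchange_big; apply: eq_bigr => i _.
rewrite /series /= mulr_suml mulr_sumr; apply: eq_bigr => k _.
rewrite !mulr_sumr; apply: eq_bigr => l _.
by rewrite /pole_coef /hurwitz_term /half_int; ring.
Qed.

(** [partial_fraction] summed over all pairs; exchanging [k] and [l] brings the
    residues at [y] to the shape of those at [x]. *)
Lemma offdiag_sum_identity m p q N : (0 < m + p)%N ->
  \sum_(i < q.+1) 'C(m + i - 1, i)%:R * 'C(p + (q.+1 - i.+1) - 1, q.+1 - i.+1)%:R
    * (series (hurwitz_term 2^-1 (m + i)) N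
       * series (hurwitz_term 2^-1 (p + (q.+1 - i.+1))) N)
  - 'C(m + p + q - 1, q)%:R * series (hurwitz_term 2^-1 (m + p + q)) N =
  (-1) ^+ p * (\sum_(i < m)
    'C(p + i - 1, i)%:R * 'C(q.+1 + (m - i.+1) - 1, m - i.+1)%:R
    * offdiag_sum (p + i) (q.+1 + (m - i.+1)) N)
  + (-1) ^+ m * (\sum_(i < p)
    'C(m + i - 1, i)%:R * 'C(q.+1 + (p - i.+1) - 1, p - i.+1)%:R
    * offdiag_sum (m + i) (q.+1 + (p - i.+1)) N) :> R.
Proof.
move=> mp; rewrite -sum_convol_pole -!sum_convol_offdiag.
rewrite [X in _ = _ + _ * X](exchange_big_dep xpredT) //= !mulr_sumr -big_split /=.
apply: eq_bigr => k _.
under [X in _ = _ + _ * X]eq_bigl => l do rewrite eq_sym.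
rewrite !mulr_sumr -big_split /=; apply: eq_bigr => l lk.
apply: partial_fraction => //; try exact: half_int_neq0.
by rewrite /half_int (inj_eq (addIr _)) eqr_nat eq_sym.
Qed.

Lemma cvg_sum_scaled n (c : 'I_n -> R) (f : 'I_n -> R ^nat) (l : 'I_n -> R) :
  (forall i, f i @ \oo --> l i) ->
  \sum_(i < n) c i * f i N @[N --> \oo] --> \sum_(i < n) c i * l i.
Proof.
move=> cf; apply: cvg_big => [|i _]; first exact: add_continuous.
by apply: cvgMl_tmp; exact: cf.
Qed.

(** The limit of [offdiag_sum_identity]; [m, p, q.+1 >= 2] makes every series
    involved converge. *)
Lemma ttilde_doubleT_relation m p q : (2 <= m)%N -> (2 <= p)%N -> (1 <= q)%N ->
  let T s b := (1 + (-1) ^+ s) * zeta R s * ttilde R b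
                 - 2 ^+ (s + b) / 4 * doubleT R s b in
  \sum_(i < q.+1) 'C(m + i - 1, i)%:R * 'C(p + (q.+1 - i.+1) - 1, q.+1 - i.+1)%:R
    * (ttilde R (m + i) * ttilde R (p + (q.+1 - i.+1)))
  - 'C(m + p + q - 1, q)%:R * ttilde R (m + p + q) =
  (-1) ^+ p * (\sum_(i < m)
    'C(p + i - 1, i)%:R * 'C(q.+1 + (m - i.+1) - 1, m - i.+1)%:R
    * T (p + i)%N (q.+1 + (m - i.+1))%N)
  + (-1) ^+ m * (\sum_(i < p)
    'C(m + i - 1, i)%:R * 'C(q.+1 + (p - i.+1) - 1, p - i.+1)%:R
    * T (m + i)%N (q.+1 + (p - i.+1))%N).
Proof.
move=> m2 p2 q1 T.
have mp : (0 < m + p)%N by lia.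
have cT s b : (2 <= s)%N -> (2 <= b)%N -> offdiag_sum s b @ \oo --> T s b.
  exact: cvg_offdiag_sum.
have ct s : (2 <= s)%N -> series (hurwitz_term 2^-1 s) @ \oo --> ttilde R s.
  exact: cvg_ttilde.
have cL : (\sum_(i < q.+1)
      'C(m + i - 1, i)%:R * 'C(p + (q.+1 - i.+1) - 1, q.+1 - i.+1)%:R
      * (series (hurwitz_term 2^-1 (m + i)) N
         * series (hurwitz_term 2^-1 (p + (q.+1 - i.+1))) N)
    - 'C(m + p + q - 1, q)%:R * series (hurwitz_term 2^-1 (m + p + q)) N)
    @[N --> \oo] -->
    \sum_(i < q.+1) 'C(m + i - 1, i)%:R * 'C(p + (q.+1 - i.+1) - 1, q.+1 - i.+1)%:R
      * (ttilde R (m + i) * ttilde R (p + (q.+1 - i.+1)))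
    - 'C(m + p + q - 1, q)%:R * ttilde R (m + p + q).
  apply: cvgB; last by apply: cvgMl_tmp; apply: ct; lia.
  by apply: cvg_sum_scaled => i; apply: cvgM; apply: ct; lia.
rewrite (funext (fun N => offdiag_sum_identity q N mp)) in cL.
apply: (norm_cvg_unique cL) => /=.
apply: cvgD; apply: cvgMl_tmp.
  by apply: cvg_sum_scaled => i; apply: cT; lia.
by apply: cvg_sum_scaled => i; apply: cT; lia.
Qed.

End HalfIntegers.

(** * The algebra of zeta values *)

Section ZetaAlgebra.
Variable R : realType.

Lemma zeta_algebraP : rat_subalgebra (zeta_algebra R).
Proof.
split=> [c|x y zx zy|x y zx zy] S [Salg zS]; case: (Salg) => Sc SD SM.
- exact: Sc.
- by apply: SD; [exact: zx|exact: zy].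
- by apply: SM; [exact: zx|exact: zy].
Qed.

Lemma zeta_algebra_rat c : zeta_algebra R (ratr c).
Proof. by case: zeta_algebraP. Qed.

Lemma zeta_algebraD x y : zeta_algebra R x -> zeta_algebra R y -> zeta_algebra R (x + y).
Proof. by case: zeta_algebraP => _ + _; apply. Qed.

Lemma zeta_algebraM x y : zeta_algebra R x -> zeta_algebra R y -> zeta_algebra R (x * y).
Proof. by case: zeta_algebraP => _ _; apply. Qed.

Lemma zeta_algebra_nat n : zeta_algebra R n%:R.
Proof. by rewrite -(ratr_nat R n); exact: zeta_algebra_rat. Qed.

Lemma zeta_algebraN x : zeta_algebra R x -> zeta_algebra R (- x).
Proof.
move=> zx; rewrite -mulN1r; apply: zeta_algebraM zx.
by have := zeta_algebra_rat (- 1); rewrite rmorphN1.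
Qed.

Lemma zeta_algebra_sum (I : finType) (P : pred I) (f : I -> R) :
  (forall i, P i -> zeta_algebra R (f i)) -> zeta_algebra R (\sum_(i | P i) f i).
Proof.
by move=> zf; apply: big_ind => //; [exact: (zeta_algebra_nat 0)|exact: zeta_algebraD].
Qed.

Lemma zeta_algebra_sign n : zeta_algebra R ((-1) ^+ n).
Proof.
rewrite -signr_odd; case: odd; rewrite ?expr1; last exact: (zeta_algebra_nat 1).
by apply: zeta_algebraN; exact: (zeta_algebra_nat 1).
Qed.

Lemma zeta_algebra_zeta s : (2 <= s)%N -> zeta_algebra R (zeta R s).
Proof. by move=> s2; apply: sub_gen_smallest; exists s. Qed.

Lemma zeta_algebra_ttilde s : (2 <= s)%N -> zeta_algebra R (ttilde R s).
Proof.
move=> s2; rewrite ttilde_zeta //; apply: zeta_algebraM; last exact: zeta_algebra_zeta.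
rewrite -natrX; apply: zeta_algebraD; first exact: zeta_algebra_nat.
by apply: zeta_algebraN; exact: (zeta_algebra_nat 1).
Qed.

End ZetaAlgebra.

Local Close Scope classical_set_scope.

(** * The relation between double T-values *)

Theorem theorem4p4 (R : realType) (m p q : nat)
    (hm : (2 <= m)%N) (hp : (2 <= p)%N) (hq : (2 <= q)%N) :
  let A : R :=
    (-1) ^+ m * (\sum_(i < p) \sum_(j < p | (i + j == p - 1)%N)
        'C(m + i - 1, i)%:R * 'C(q + j - 1, j)%:R * doubleT R (m + i) (q + j))
    + (-1) ^+ p * (\sum_(i < m) \sum_(j < m | (i + j == m - 1)%N)
        'C(p + i - 1, i)%:R * 'C(q + j - 1, j)%:R * doubleT R (p + i) (q + j))
  in
  zeta_algebra R A /\
  2 ^+ (m + p + q - 3) * A =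
    'C(m + p + q - 2, q - 1)%:R * ttilde R (m + p + q - 1)
    + (-1) ^+ m * (\sum_(i < p) \sum_(j < p | (i + j == p - 1)%N)
        'C(m + i - 1, i)%:R * 'C(q + j - 1, j)%:R
        * (1 + (-1) ^+ (m + i)) * zeta R (m + i) * ttilde R (q + j))
    + (-1) ^+ p * (\sum_(i < m) \sum_(j < m | (i + j == m - 1)%N)
        'C(p + i - 1, i)%:R * 'C(q + j - 1, j)%:R
        * (1 + (-1) ^+ (p + i)) * zeta R (p + i) * ttilde R (q + j))
    - \sum_(i < q) \sum_(j < q | (i + j == q - 1)%N)
        'C(m + i - 1, i)%:R * 'C(p + j - 1, j)%:R
        * ttilde R (m + i) * ttilde R (p + j).
Proof.
move=> A; set RHS := (X in _ /\ _ = X).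
suff formula : 2 ^+ (m + p + q - 3) * A = RHS.
  split=> //.
  have p2 : 2 ^+ (m + p + q - 3) != 0 :> R by rewrite expf_neq0.
  have -> : A = ratr (2 ^+ (m + p + q - 3))^-1 * RHS.
    by rewrite fmorphV rmorphXn /= ratr_nat -formula mulKf.
  apply: zeta_algebraM; first exact: zeta_algebra_rat.
  have zconv n a : (2 <= a)%N -> zeta_algebra R
      (\sum_(i < n) \sum_(j < n | (i + j == n - 1)%N)
        'C(a + i - 1, i)%:R * 'C(q + j - 1, j)%:R
        * (1 + (-1) ^+ (a + i)) * zeta R (a + i) * ttilde R (q + j)).
    move=> a2; apply: zeta_algebra_sum => i _; apply: zeta_algebra_sum => j _.
    apply: zeta_algebraM; last by apply: zeta_algebra_ttilde; lia.
    apply: zeta_algebraM; last by apply: zeta_algebra_zeta; lia.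
    apply: zeta_algebraM; first by apply: zeta_algebraM; exact: zeta_algebra_nat.
    by apply: zeta_algebraD; [exact: (zeta_algebra_nat 1)|exact: zeta_algebra_sign].
  apply: zeta_algebraD; last first.
    apply: zeta_algebraN; apply: zeta_algebra_sum => i _.
    apply: zeta_algebra_sum => j _.
    apply: zeta_algebraM; last by apply: zeta_algebra_ttilde; lia.
    apply: zeta_algebraM; last by apply: zeta_algebra_ttilde; lia.
    by apply: zeta_algebraM; exact: zeta_algebra_nat.
  apply: zeta_algebraD; last by apply: zeta_algebraM; [exact: zeta_algebra_sign|exact: zconv].
  apply: zeta_algebraD; last by apply: zeta_algebraM; [exact: zeta_algebra_sign|exact: zconv].
  apply: zeta_algebraM; first exact: zeta_algebra_nat.
  by apply: zeta_algebra_ttilde; lia.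
rewrite {}/RHS {}/A; case: q hq => // q' hq'.
have := @ttilde_doubleT_relation R m p q' hm hp hq'; cbv zeta.
have split n a : (a + n = m + p)%N ->
  \sum_(i < n) 'C(a + i - 1, i)%:R * 'C(q'.+1 + (n - i.+1) - 1, n - i.+1)%:R
    * ((1 + (-1) ^+ (a + i)) * zeta R (a + i) * ttilde R (q'.+1 + (n - i.+1))
       - 2 ^+ (a + i + (q'.+1 + (n - i.+1))) / 4 * doubleT R (a + i) (q'.+1 + (n - i.+1))) =
  \sum_(i < n) \sum_(j < n | (i + j == n - 1)%N)
      'C(a + i - 1, i)%:R * 'C(q'.+1 + j - 1, j)%:R
      * (1 + (-1) ^+ (a + i)) * zeta R (a + i) * ttilde R (q'.+1 + j)
  - 2 ^+ (m + p + q'.+1 - 3) * \sum_(i < n) \sum_(j < n | (i + j == n - 1)%N)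
      'C(a + i - 1, i)%:R * 'C(q'.+1 + j - 1, j)%:R * doubleT R (a + i) (q'.+1 + j).
  move=> an.
  rewrite (sum_antidiag n (fun i j => 'C(a + i - 1, i)%:R * 'C(q'.+1 + j - 1, j)%:R
      * (1 + (-1) ^+ (a + i)) * zeta R (a + i) * ttilde R (q'.+1 + j))).
  rewrite (sum_antidiag n (fun i j => 'C(a + i - 1, i)%:R * 'C(q'.+1 + j - 1, j)%:R
      * doubleT R (a + i) (q'.+1 + j))).
  rewrite mulr_sumr -sumrB; apply: eq_bigr => i _.
  (* every [doubleT] here has weight [m + p + q - 1], hence one common scaling *)
  have -> : (a + i + (q'.+1 + (n - i.+1)) = (m + p + q'.+1 - 3) + 2)%N.
    by have := ltn_ord i; lia.
  by rewrite [2 ^+ (_ + 2)]exprD; field.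
rewrite (split m p (addnC p m)) (split p m erefl).
rewrite (sum_antidiag q'.+1 (fun i j => 'C(m + i - 1, i)%:R * 'C(p + j - 1, j)%:R
      * ttilde R (m + i) * ttilde R (p + j))).
have -> : (m + p + q'.+1 - 2 = m + p + q' - 1)%N by lia.
have -> : (m + p + q'.+1 - 1 = m + p + q')%N by lia.
have -> : (q'.+1 - 1 = q')%N by rewrite subn1.
under eq_bigr => i _ do rewrite mulrA.
move: (\sum_(i < q'.+1) _) => S Heq.
rewrite [RHS](_ : _ = - (S - 'C(m + p + q' - 1, q')%:R * ttilde R (m + p + q'))
 + (-1) ^+ m * (\sum_(i < p) \sum_(j < p | (i + j == p - 1)%N)
        'C(m + i - 1, i)%:R * 'C(q'.+1 + j - 1, j)%:R
        * (1 + (-1) ^+ (m + i)) * zeta R (m + i) * ttilde R (q'.+1 + j))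
    + (-1) ^+ p * (\sum_(i < m) \sum_(j < m | (i + j == m - 1)%N)
        'C(p + i - 1, i)%:R * 'C(q'.+1 + j - 1, j)%:R
        * (1 + (-1) ^+ (p + i)) * zeta R (p + i) * ttilde R (q'.+1 + j))); last by ring.
by rewrite Heq; ring.
Qed.
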